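(* Suppose that $\operatorname{clos} J_{\min}\neq J_{\max}$. Then for all $z\in\mathbb{C}$ the operator $\mathcal{R}(z)$ maps $\ell^2(\mathbb{Z}_+)$ into $\mathcal{D}(J_{\max})$ and $$(J_{\max}-zI)\,\mathcal{R}(z)=I .$$
   Context: Let $\mathbb{Z}_+=\{0,1,2,\dots\}$, let $a_n>0$ and $b_n\in\mathbb{R}$ for $n\in\mathbb{Z}_+$, and for a sequence $u=(u_n)_{n\ge 0}$ of complex numbers put $(\mathcal{J}u)_0=b_0u_0+a_0u_1$ and $(\mathcal{J}u)_n=a_{n-1}u_{n-1}+b_nu_n+a_nu_{n+1}$ for $n\ge 1$. For $z\in\mathbb{C}$, $p(z)=(p_n(z))_{n\ge0}$ and $q(z)=(q_n(z))_{n\ge0}$ are the solutions of $a_{n-1}u_{n-1}+b_nu_n+a_nu_{n+1}=zu_n$, $n\ge1$, with $p_0(z)=1$, $p_1(z)=(z-b_0)/a_0$, $q_0(z)=0$, $q_1(z)=1/a_0$. The space $\ell^2(\mathbb{Z}_+)$ has scalar product $\langle u,v\rangle=\sum_n u_n\overline{v_n}$. The operator $J_{\min}$ acts by $J_{\min}u=\mathcal{J}u$ on the set $\mathcal{D}$ of finitely supported sequences; $J_{\max}$ acts by $J_{\max}u=\mathcal{J}u$ on $\mathcal{D}(J_{\max})=\{u\in\ell^2(\mathbb{Z}_+):\mathcal{J}u\in\ell^2(\mathbb{Z}_+)\}$; one has $J_{\min}^*=J_{\max}$. $\operatorname{clos}$ denotes operator closure. It is known that if $\operatorname{clos}J_{\min}\ne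 J_{\max}$ (limit circle case), then $p(z),q(z)\in\ell^2(\mathbb{Z}_+)$ for all $z\in\mathbb{C}$. In this case, for every $z\in\mathbb{C}$, $\mathcal{R}(z)$ is the bounded operator on $\ell^2(\mathbb{Z}_+)$ defined by $$(\mathcal{R}(z)h)_n=q_n(z)\sum_{m=0}^n p_m(z)h_m+p_n(z)\sum_{m=n+1}^\infty q_m(z)h_m .$$ *)

(* Defs.v *)
From Stdlib Require Import Reals Lra.
From Coquelicot Require Import Coquelicot.

Open Scope C_scope.

Definition cseq : Type := nat -> C.

Definition ell2 (u : cseq) : Prop := ex_series (fun n => (Cmod (u n) ^ 2)%R).

Definition ell2_norm (u : cseq) : R :=
  sqrt (Series (fun n => (Cmod (u n) ^ 2)%R)).

Definition ell2_cvg (f : nat -> cseq) (u : cseq) : Prop :=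
  (forall k, ell2 (f k)) /\ ell2 u /\
  is_lim_seq (fun k => ell2_norm (fun n => f k n - u n)) 0%R.

(** Possibly unbounded, not everywhere defined operators in [ell2] are
    identified with their graphs; equality of operators is equality of graphs,
    hence includes equality of the domains. *)
Definition operator : Type := cseq -> cseq -> Prop.

Definition dom (T : operator) (u : cseq) : Prop := exists v, T u v.

Definition op_eq (S T : operator) : Prop := forall u v, S u v <-> T u v.

Definition op_id : operator := fun u v => ell2 u /\ v = u.

Definition op_comp (S T : operator) : operator :=
  fun u w => exists v, T u v /\ S v w.

(** [T - z I], with domain that of [T]. *)
Definition op_shift (T : operator) (z : C) : operator :=
  fun u w => exists v, T u v /\ w = (fun n => v n - z * u n).

(** The closure of the graph in [ell2 x ell2]. *)
Definition clos (T : operator) : operator :=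
  fun u v => exists f g : nat -> cseq,
    (forall k, T (f k) (g k)) /\ ell2_cvg f u /\ ell2_cvg g v.

Definition finitely_supported (u : cseq) : Prop :=
  exists N : nat, forall n : nat, (N <= n)%nat -> u n = 0.

Definition jacobi (a b : nat -> R) (u : cseq) : cseq := fun n =>
  match n with
  | O => b 0%nat * u 0%nat + a 0%nat * u 1%nat
  | S m => a m * u m + b n * u n + a n * u (S n)
  end.

Definition Jmin (a b : nat -> R) : operator :=
  fun u v => finitely_supported u /\ v = jacobi a b u.

Definition Jmax (a b : nat -> R) : operator :=
  fun u v => (ell2 u /\ ell2 (jacobi a b u)) /\ v = jacobi a b u.

(** The solution of [a_{n-1} u_{n-1} + b_n u_n + a_n u_{n+1} = z u_n], [n >= 1],
    with initial values [u0], [u1]; see [solution_rec]. *)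
Fixpoint solution (a b : nat -> R) (z u0 u1 : C) (n : nat) : C :=
  match n with
  | O => u0
  | S m =>
      match m with
      | O => u1
      | S k => ((z - b m) * solution a b z u0 u1 m
                - a k * solution a b z u0 u1 k) / a m
      end
  end.

Lemma solution_rec (a b : nat -> R) (ha : forall n, (0 < a n)%R)
    (z u0 u1 : C) (n : nat) :
  let u := solution a b z u0 u1 in
  a n * u n + b (S n) * u (S n) + a (S n) * u (S (S n)) = z * u (S n).
Proof.
intro u.
assert (h : RtoC (a (S n)) <> 0).
{ intro e; apply RtoC_inj in e; specialize (ha (S n)); lra. }
change (u (S (S n))) with (((z - b (S n)) * u (S n) - a n * u n) / a (S n)).
field; exact h.
Qed.

Definition pseq (a b : nat -> R) (z : C) : cseq :=
  solution a b z 1 ((z - b 0%nat) / a 0%nat).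

Definition qseq (a b : nat -> R) (z : C) : cseq :=
  solution a b z 0 (1 / a 0%nat).

(** [resolvent a b z h g] says that [g = R(z) h]; that the infinite series
    defining [g n] converge is part of the relation. *)
Definition resolvent (a b : nat -> R) (z : C) : operator :=
  fun h g => ell2 h /\
    forall n : nat, exists s : C,
      is_series (fun k => qseq a b z (n + 1 + k)%nat * h (n + 1 + k)%nat) s /\
      g n = qseq a b z n * sum_n (fun m => pseq a b z m * h m) n
            + pseq a b z n * s.

(* Main.v *)
Require Import Defs.
From Stdlib Require Import Reals Lra Lia ClassicalEpsilon FunctionalExtensionality.
From Coquelicot Require Import Coquelicot.

(** If [p(i)] is not in [ell2], then [clos Jmin = Jmax]: for [u] in the domain of
    [Jmax] minimise [|(J - i) v - (J - i) u|] over finitely supported [v].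
    Minimising sequences are Cauchy together with their images under [J]; the
    residual of the limit [t] is a solution of [J r = - i r], and [t - u] is a
    solution of [J w = i w]; both are in [ell2], hence zero. So in the limit
    circle case [p(i)] is in [ell2], and [q(i)] is too since
    [|q_n(i)| <= |p_n(i)|]. Variation of constants and a Gronwall estimate carry
    this over to all [z]. Finally [R(z) h] is the variation of constants formula
    for [(J - z) g = h], and it is dominated by a multiple of [|p| + |q|]. *)

Local Open Scope R_scope.

(** That [p(z)] and [q(z)] lie in [ell2] is not assumed: the hypothesis only says that two graphs
    differ, and most of the proof extracts square-summability from it. No adjoint is introduced; the
    orthogonal complement of the range of [J - i] is reached through minimisation. The point [i]
    serves because [a] and [b] are real: the sum of the imaginary parts of [(J - i) u] times the
    conjugate of [u] telescopes to a boundary term minus the sum of [|u_k|^2]. This one identity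
    makes the minimising [v] Cauchy, shows that [p_n(i)] never vanishes, and puts [- q_n / p_n] in
    the unit disc for [n >= 1]. Conjugation exchanges [i] and [- i], so that [p(i)] alone decides
    both kernels. For [R(z)], each tail of the series of [q_m h_m] is its sum [s] minus a partial
    sum; this leaves finite sums and one constant, and [(J - z) R(z) h = h] becomes algebra in each
    row. *)

Lemma sum_n_SR (f : nat -> R) (n : nat) : sum_n f (S n) = sum_n f n + f (S n).
Proof. exact (sum_Sn f n). Qed.

Lemma sum_n_SC (f : nat -> C) (n : nat) :
  sum_n f (S n) = (sum_n f n + f (S n))%C.
Proof. exact (sum_Sn f n). Qed.

Lemma sum_n_OR (f : nat -> R) : sum_n f 0 = f 0%nat.
Proof. exact (sum_O f). Qed.

Lemma sum_n_OC (f : nat -> C) : sum_n f 0 = f 0%nat.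
Proof. exact (sum_O f). Qed.

Lemma Cmod_sum_n_le (f : nat -> C) (n : nat) :
  Cmod (sum_n f n) <= sum_n (fun k => Cmod (f k)) n.
Proof.
induction n as [|n IH].
- rewrite !sum_n_OC, sum_n_OR; lra.
- rewrite sum_n_SC, sum_n_SR.
  eapply Rle_trans; [apply Cmod_triangle|]; lra.
Qed.

Lemma Cmod_parallelogram (x y : C) :
  Cmod (x + y) ^ 2 + Cmod (x - y) ^ 2 = 2 * Cmod x ^ 2 + 2 * Cmod y ^ 2.
Proof. rewrite !Cmod2_alt; destruct x, y; simpl; ring. Qed.

Lemma Cmod_plus_sqr (x y : C) :
  Cmod (x + y) ^ 2 <= 2 * Cmod x ^ 2 + 2 * Cmod y ^ 2.
Proof.
rewrite <- Cmod_parallelogram; pose proof (pow2_ge_0 (Cmod (x - y))); lra.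
Qed.

Lemma term_le_sum_n (f : nat -> R) (k n : nat) :
  (forall i, 0 <= f i) -> (k <= n)%nat -> f k <= sum_n f n.
Proof.
intros h0 hk; induction hk as [|n hk IH].
- destruct k as [|k]; [rewrite sum_n_OR; lra|rewrite sum_n_SR].
  enough (0 <= sum_n f k) by lra.
  induction k as [|k IH]; [rewrite sum_n_OR; trivial|rewrite sum_n_SR].
  specialize (h0 (S k)); lra.
- rewrite sum_n_SR; specialize (h0 (S n)); lra.
Qed.

Lemma partial_sum_le_Series (f : nat -> R) (n : nat) :
  (forall k, 0 <= f k) -> ex_series f -> sum_n f n <= Series f.
Proof.
intros f0 hf.
apply (is_lim_seq_incr_compare (sum_n f) (Series f)).
- exact (Series_correct f hf).
- intro k; rewrite sum_n_SR; specialize (f0 (S k)); lra.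
Qed.

Lemma ex_series_bounded (f : nat -> R) (M : R) :
  (forall k, 0 <= f k) -> (forall n, sum_n f n <= M) -> ex_series f.
Proof.
intros f0 hM.
destruct (ex_finite_lim_seq_incr (sum_n f) M) as [l hl].
- intro k; rewrite sum_n_SR; specialize (f0 (S k)); lra.
- exact hM.
- exists l; exact hl.
Qed.

Lemma Series_bounded (f : nat -> R) (M : R) :
  ex_series f -> (forall n, sum_n f n <= M) -> Series f <= M.
Proof.
intros hf hM.
apply (is_lim_seq_le (sum_n f) (fun _ => M) (Series f) M hM).
- exact (Series_correct f hf).
- apply is_lim_seq_const.
Qed.

(** * Square-summable sequences *)

(** The square of [ell2_norm]: without the root, the parallelogram law and the expansion of a
    perturbed norm are plain identities between series. *)
Definition normsq (u : cseq) : R := Series (fun n => Cmod (u n) ^ 2).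

Lemma ell2_le (u : cseq) (f : nat -> R) :
  (forall n, Cmod (u n) ^ 2 <= f n) -> ex_series f -> ell2 u.
Proof.
intros h hf; apply (ex_series_le (K := R_AbsRing) (V := R_CompleteNormedModule) _ f); trivial.
intro n; change (Rabs (Cmod (u n) ^ 2) <= f n).
rewrite Rabs_pos_eq; [apply h | apply pow2_ge_0].
Qed.

Lemma ell2_lin (c d : C) (u v : cseq) :
  ell2 u -> ell2 v -> ell2 (fun n => c * u n + d * v n)%C.
Proof.
intros hu hv.
apply (ell2_le _ (fun n => 2 * Cmod c ^ 2 * Cmod (u n) ^ 2
                         + 2 * Cmod d ^ 2 * Cmod (v n) ^ 2)).
- intro n; eapply Rle_trans; [apply Cmod_plus_sqr|].
  rewrite !Cmod_mult; right; ring.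
- apply (ex_series_plus (K := R_AbsRing) (V := R_NormedModule)).
  + exact (ex_series_scal_l (K := R_AbsRing) (V := R_NormedModule) _ _ hu).
  + exact (ex_series_scal_l (K := R_AbsRing) (V := R_NormedModule) _ _ hv).
Qed.

Lemma ell2_ext (u v : cseq) : (forall n, u n = v n) -> ell2 u -> ell2 v.
Proof.
intros h; apply ex_series_ext; intro n; now rewrite h.
Qed.

Lemma ell2_plus (u v : cseq) :
  ell2 u -> ell2 v -> ell2 (fun n => u n + v n)%C.
Proof.
intros hu hv; apply (ell2_ext (fun n => 1 * u n + 1 * v n)%C).
- intro n; ring.
- now apply ell2_lin.
Qed.

Lemma ell2_minus (u v : cseq) :
  ell2 u -> ell2 v -> ell2 (fun n => u n - v n)%C.
Proof.
intros hu hv; apply (ell2_ext (fun n => 1 * u n + (- (1)) * v n)%C).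
- intro n; ring.
- now apply ell2_lin.
Qed.

Lemma ell2_scal (c : C) (u : cseq) : ell2 u -> ell2 (fun n => c * u n)%C.
Proof.
intros hu; apply (ell2_ext (fun n => c * u n + 0 * u n)%C).
- intro n; ring.
- now apply ell2_lin.
Qed.

Lemma ell2_conj (u : cseq) : ell2 u -> ell2 (fun n => Cconj (u n)).
Proof.
apply ex_series_ext; intro n; now rewrite Cmod_conj.
Qed.

Lemma finitely_supported_ell2 (u : cseq) : finitely_supported u -> ell2 u.
Proof.
intros [N hN].
apply (ex_series_incr_n (K := R_AbsRing) (V := R_NormedModule) _ N).
apply (ex_series_ext (K := R_AbsRing) (V := R_NormedModule) (fun _ => 0)).
- intro k; rewrite hN by lia; rewrite Cmod_0; simpl; ring.
- exists 0; change (is_lim_seq (sum_n (fun _ => 0)) 0).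
  apply (is_lim_seq_ext (fun _ => 0)).
  + intro n; induction n as [|n IH].
    * now rewrite sum_n_OR.
    * rewrite sum_n_SR, <- IH; ring.
  + apply is_lim_seq_const.
Qed.

Lemma ell2_mult (u v : cseq) :
  ell2 u -> ell2 v -> ex_series (fun n => Cmod (u n) * Cmod (v n)).
Proof.
intros hu hv.
apply (ex_series_le (K := R_AbsRing) (V := R_CompleteNormedModule) _
  (fun n => Cmod (u n) ^ 2 + Cmod (v n) ^ 2)).
- intro n.
  change (Rabs (Cmod (u n) * Cmod (v n)) <= Cmod (u n) ^ 2 + Cmod (v n) ^ 2).
  pose proof (Cmod_ge_0 (u n)); pose proof (Cmod_ge_0 (v n)).
  rewrite Rabs_pos_eq by nra.
  nra.
- exact (ex_series_plus (K := R_AbsRing) (V := R_NormedModule) _ _ hu hv).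
Qed.

Lemma normsq_ext (u v : cseq) : (forall n, u n = v n) -> normsq u = normsq v.
Proof. intro h; apply Series_ext; intro n; now rewrite h. Qed.

Lemma partial_sum_le_normsq (u : cseq) (n : nat) :
  ell2 u -> sum_n (fun k => Cmod (u k) ^ 2) n <= normsq u.
Proof.
intro hu; apply partial_sum_le_Series; trivial.
intro k; apply pow2_ge_0.
Qed.

Lemma Cmod_le_normsq (u : cseq) (n : nat) :
  ell2 u -> Cmod (u n) ^ 2 <= normsq u.
Proof.
intro hu; eapply Rle_trans; [|apply (partial_sum_le_normsq u n hu)].
apply (term_le_sum_n (fun k => Cmod (u k) ^ 2)); [|lia].
intro k; apply pow2_ge_0.
Qed.

Lemma normsq_ge_0 (u : cseq) : ell2 u -> 0 <= normsq u.
Proof.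
intro hu; eapply Rle_trans; [|apply (Cmod_le_normsq u 0 hu)]; apply pow2_ge_0.
Qed.

Lemma normsq_scal (c : C) (u : cseq) :
  normsq (fun n => c * u n)%C = Cmod c ^ 2 * normsq u.
Proof.
unfold normsq; rewrite <- Series_scal_l; apply Series_ext; intro n.
rewrite Cmod_mult; ring.
Qed.

Lemma normsq_parallelogram (u v : cseq) : ell2 u -> ell2 v ->
  normsq (fun n => u n + v n)%C + normsq (fun n => u n - v n)%C
  = 2 * normsq u + 2 * normsq v.
Proof.
intros hu hv; unfold normsq.
rewrite <- Series_plus; [|now apply ell2_plus|now apply ell2_minus].
rewrite <- !Series_scal_l, <- Series_plus.
- apply Series_ext; intro n; apply Cmod_parallelogram.
- exact (ex_series_scal_l (K := R_AbsRing) (V := R_NormedModule) _ _ hu).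
- exact (ex_series_scal_l (K := R_AbsRing) (V := R_NormedModule) _ _ hv).
Qed.

Lemma normsq_plus_le (u v : cseq) : ell2 u -> ell2 v ->
  normsq (fun n => u n + v n)%C <= 2 * normsq u + 2 * normsq v.
Proof.
intros hu hv; rewrite <- normsq_parallelogram by trivial.
pose proof (normsq_ge_0 _ (ell2_minus u v hu hv)); lra.
Qed.

Lemma ell2_cvg_normsq (f : nat -> cseq) (u : cseq) :
  (forall k, ell2 (f k)) -> ell2 u ->
  is_lim_seq (fun k => normsq (fun n => f k n - u n)%C) 0 -> ell2_cvg f u.
Proof.
intros hf hu hl; split; [|split]; trivial.
rewrite <- sqrt_0.
apply (is_lim_seq_continuous sqrt); trivial.
apply continuity_pt_sqrt; lra.
Qed.

Lemma is_lim_seq_C_components (f : nat -> C) (l : C) :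
  is_lim_seq (fun k => Re (f k)) (Re l) ->
  is_lim_seq (fun k => Im (f k)) (Im l) ->
  is_lim_seq (fun k => Cmod (f k - l)%C) 0.
Proof.
intros h1 h2.
apply (is_lim_seq_ext (fun k => sqrt ((Re (f k) - Re l) ^ 2 + (Im (f k) - Im l) ^ 2))).
- intro k; unfold Cmod, Re, Im, Cminus, Copp, Cplus; simpl; reflexivity.
- replace (Finite 0) with (Finite (sqrt ((Re l - Re l) ^ 2 + (Im l - Im l) ^ 2))).
  2: { f_equal; replace ((Re l - Re l) ^ 2 + (Im l - Im l) ^ 2) with 0 by ring; apply sqrt_0. }
  apply (is_lim_seq_continuous sqrt).
  + apply continuity_pt_sqrt; nra.
  + simpl pow.
    assert (hm : forall (x : nat -> R) (r : R), is_lim_seq x r ->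
      is_lim_seq (fun k => (x k - r) * ((x k - r) * 1)) ((r - r) * ((r - r) * 1))).
    { intros x r hx; pose proof (is_lim_seq_minus' _ _ _ _ hx (is_lim_seq_const r)) as h.
      exact (is_lim_seq_mult' _ _ _ _ h (is_lim_seq_mult' _ _ _ _ h (is_lim_seq_const 1))). }
    exact (is_lim_seq_plus' _ _ _ _ (hm _ _ h1) (hm _ _ h2)).
Qed.

Lemma ell2_cvg_pointwise (f : nat -> cseq) (u : cseq) (n : nat) :
  ell2_cvg f u -> is_lim_seq (fun k => Cmod (f k n - u n)%C) 0.
Proof.
intros [hf [hu hl]].
apply (is_lim_seq_le_le (fun _ => 0) _ (fun k => ell2_norm (fun n => f k n - u n)%C)); trivial.
2: apply is_lim_seq_const.
intro k; split; [apply Cmod_ge_0|].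
rewrite <- (sqrt_pow2 (Cmod _)) by apply Cmod_ge_0.
apply sqrt_le_1_alt.
exact (Cmod_le_normsq (fun n => f k n - u n)%C n (ell2_minus _ _ (hf k) hu)).
Qed.

(** The limit is taken entrywise. A partial sum of fixed length passes to this limit, and the bounds
    so obtained are uniform in the length, which gives both membership in [ell2] and convergence in
    norm. *)
Lemma ell2_complete (f : nat -> cseq) :
  (forall k, ell2 (f k)) ->
  (forall eps, 0 < eps -> exists N : nat, forall k l, (N <= k)%nat -> (N <= l)%nat ->
     normsq (fun n => f k n - f l n)%C <= eps) ->
  exists u, ell2_cvg f u.
Proof.
intros hf hc.
assert (hcn : forall n (eps : posreal), exists N : nat,
  forall k l, (N <= k)%nat -> (N <= l)%nat -> Cmod (f k n - f l n)%C < eps).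
{ intros n eps.
  pose proof (cond_pos eps) as he.
  destruct (hc ((eps / 2) ^ 2)) as [N hN]; [nra|].
  exists N; intros k l hk hl.
  pose proof (Cmod_le_normsq _ n (ell2_minus _ _ (hf k) (hf l))) as h1.
  specialize (hN k l hk hl); simpl in h1.
  pose proof (Cmod_ge_0 (f k n - f l n)%C) as h2.
  apply Rnot_le_lt; intro h3; nra. }
pose (u := fun n => (real (Lim_seq (fun k => Re (f k n))),
                     real (Lim_seq (fun k => Im (f k n)))) : C).
assert (hp : forall n, is_lim_seq (fun k => Cmod (f k n - u n)%C) 0).
{ intro n; apply is_lim_seq_C_components; apply Lim_seq_correct';
  apply ex_lim_seq_cauchy_corr; intro eps; destruct (hcn n eps) as [N hN];
  exists N; intros k l hk hl; (eapply Rle_lt_trans; [|apply (hN k l hk hl)]).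
  - exact (re_le_Cmod (f k n - f l n)%C).
  - exact (Rle_trans _ _ _ (Rmax_r _ _) (Rmax_Cmod (f k n - f l n)%C)). }
assert (hs : forall M, is_lim_seq
  (fun l => sum_n (fun n => Cmod (f l n - u n)%C ^ 2) M) 0).
{ assert (h2 : forall n, is_lim_seq (fun l => Cmod (f l n - u n)%C ^ 2) 0).
  { intro n; replace (Finite 0) with (Finite (0 * (0 * 1))) by (f_equal; ring).
    exact (is_lim_seq_mult' _ _ _ _ (hp n)
      (is_lim_seq_mult' _ _ _ _ (hp n) (is_lim_seq_const 1))). }
  intro M; induction M as [|M IH].
  - apply (is_lim_seq_ext (fun l => Cmod (f l 0%nat - u 0%nat)%C ^ 2)); trivial.
    intro l; now rewrite sum_n_OR.
  - apply (is_lim_seq_ext (fun l => sum_n (fun n => Cmod (f l n - u n)%C ^ 2) M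
      + Cmod (f l (S M) - u (S M))%C ^ 2)).
    + intro l; now rewrite sum_n_SR.
    + replace (Finite 0) with (Finite (0 + 0)) by (f_equal; ring).
      now apply is_lim_seq_plus'. }
(* Let [l] tend to infinity with [M] fixed. The factor 2 of [Cmod_plus_sqr] is why the Cauchy
   condition is used at [eps / 2]. *)
assert (hb : forall eps, 0 < eps -> exists N : nat, forall k, (N <= k)%nat -> forall M,
  sum_n (fun n => Cmod (f k n - u n)%C ^ 2) M <= eps).
{ intros eps he; destruct (hc (eps / 2)) as [N hN]; [lra|].
  exists N; intros k hk M.
  apply (is_lim_seq_le_loc
    (fun _ => sum_n (fun n => Cmod (f k n - u n)%C ^ 2) M)
    (fun l => eps + 2 * sum_n (fun n => Cmod (f l n - u n)%C ^ 2) M)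
    (sum_n (fun n => Cmod (f k n - u n)%C ^ 2) M) eps).
  - exists N; intros l hl.
    pose proof (partial_sum_le_normsq _ M (ell2_minus _ _ (hf k) (hf l))) as h1.
    specialize (hN k l hk hl).
    enough (h3 : sum_n (fun n => Cmod (f k n - u n)%C ^ 2) M
      <= 2 * sum_n (fun n => Cmod (f k n - f l n)%C ^ 2) M
       + 2 * sum_n (fun n => Cmod (f l n - u n)%C ^ 2) M) by lra.
    assert (h4 : forall n, Cmod (f k n - u n)%C ^ 2
      <= 2 * Cmod (f k n - f l n)%C ^ 2 + 2 * Cmod (f l n - u n)%C ^ 2).
    { intro n; replace (f k n - u n)%C with ((f k n - f l n) + (f l n - u n))%C by ring.
      apply Cmod_plus_sqr. }
    clear - h4; induction M as [|M IH].
    + rewrite !sum_n_OR; apply h4.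
    + rewrite !sum_n_SR; specialize (h4 (S M)); lra.
  - apply is_lim_seq_const.
  - replace (Finite eps) with (Finite (eps + 2 * 0)) by (f_equal; ring).
    apply is_lim_seq_plus'; [apply is_lim_seq_const|].
    apply is_lim_seq_mult'; [apply is_lim_seq_const|apply hs]. }
assert (hu : ell2 u).
{ destruct (hb 1) as [N hN]; [lra|].
  apply (ell2_ext (fun n => f N n - (f N n - u n))%C); [intro n; ring|].
  apply ell2_minus; trivial.
  apply (ex_series_bounded _ 1); [intro n; apply pow2_ge_0|].
  exact (hN N (le_n N)). }
exists u; apply ell2_cvg_normsq; trivial.
apply is_lim_seq_spec; intro eps; pose proof (cond_pos eps) as he.
destruct (hb (eps / 2)) as [N hN]; [lra|].
exists N; intros k hk.
assert (h0 := ell2_minus _ _ (hf k) hu).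
rewrite Rminus_0_r, Rabs_pos_eq by now apply normsq_ge_0.
apply Rle_lt_trans with (eps / 2); [|lra].
exact (Series_bounded _ _ h0 (hN k hk)).
Qed.

(** * The Jacobi difference expression *)

Definition jshift (a b : nat -> R) (z : C) (u : cseq) : cseq :=
  fun n => (jacobi a b u n - z * u n)%C.

Lemma jacobi_lin (a b : nat -> R) (c d : C) (u v : cseq) (n : nat) :
  jacobi a b (fun k => c * u k + d * v k)%C n
  = (c * jacobi a b u n + d * jacobi a b v n)%C.
Proof. destruct n; simpl; ring. Qed.

Lemma jshift_lin (a b : nat -> R) (z c d : C) (u v : cseq) (n : nat) :
  jshift a b z (fun k => c * u k + d * v k)%C n
  = (c * jshift a b z u n + d * jshift a b z v n)%C.
Proof. unfold jshift; rewrite jacobi_lin; ring. Qed.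

Lemma jacobi_ext (a b : nat -> R) (u v : cseq) :
  (forall n, u n = v n) -> forall n, jacobi a b u n = jacobi a b v n.
Proof. intros h [|n]; simpl; now rewrite !h. Qed.

Lemma jshift_ext (a b : nat -> R) (z : C) (u v : cseq) :
  (forall n, u n = v n) -> forall n, jshift a b z u n = jshift a b z v n.
Proof. intros h n; unfold jshift; now rewrite (jacobi_ext a b u v h), h. Qed.

Lemma Cconj_R (x : R) : Cconj x = x.
Proof. unfold Cconj, RtoC; simpl; f_equal; ring. Qed.

Lemma jacobi_conj (a b : nat -> R) (u : cseq) (n : nat) :
  jacobi a b (fun k => Cconj (u k)) n = Cconj (jacobi a b u n).
Proof.
destruct n; simpl; now rewrite !Cplus_conj, !Cmult_conj, !Cconj_R.
Qed.

Lemma jacobi_finitely_supported (a b : nat -> R) (u : cseq) :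
  finitely_supported u -> finitely_supported (jacobi a b u).
Proof.
intros [N hN]; exists (S N); intros [|n] hn; [lia|].
simpl; rewrite !hN by lia; ring.
Qed.

(** Discrete Green identity: the diagonal terms cancel and the off-diagonal ones telescope. It is
    bilinear, without conjugates, so it serves both the Wronskian and, after conjugating one factor,
    the scalar product. *)
Lemma green (a b : nat -> R) (u v : cseq) (n : nat) :
  sum_n (fun k => jacobi a b u k * v k - u k * jacobi a b v k)%C n
  = (a n * (u (S n) * v n - u n * v (S n)))%C.
Proof.
induction n as [|n IH].
- rewrite sum_n_OC; simpl; ring.
- rewrite sum_n_SC, IH; simpl; ring.
Qed.

(** Since [a] and [b] are real, [b_k |u_k|^2] has no imaginary part and the neighbour terms
    telescope; the shift by [Ci] contributes [- |u_k|^2]. *)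
Lemma jshift_Ci_form (a b : nat -> R) (u : cseq) (n : nat) :
  sum_n (fun k => Im (jshift a b Ci u k * Cconj (u k))) n
  = a n * Im (u (S n) * Cconj (u n)) - sum_n (fun k => Cmod (u k) ^ 2) n :> R.
Proof.
induction n as [|n IH].
- rewrite !sum_n_OR, Cmod2_alt; unfold jshift, Re, Im; simpl; ring.
- rewrite !sum_n_SR, IH, Cmod2_alt; unfold jshift, Re, Im; simpl; ring.
Qed.

(** As [a n] is nonzero, each row determines the next entry. Row 0 already determines [w 1], so a
    single initial value fixes a solution. *)
Lemma solution_zero (a b : nat -> R) (ha : forall n, 0 < a n) (z : C) (w : cseq) :
  (forall n, jshift a b z w n = 0%C) -> w 0%nat = 0%C -> forall n, w n = 0%C.
Proof.
intros hw h0.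
assert (hz : forall n, RtoC (a n) <> 0%C).
{ intros n e; apply RtoC_inj in e; specialize (ha n); lra. }
enough (h : forall n, w n = 0%C /\ w (S n) = 0%C) by (intro n; apply h).
induction n as [|n [IH1 IH2]].
- split; trivial.
  specialize (hw 0%nat); unfold jshift in hw; simpl in hw; rewrite h0 in hw.
  replace (w 1%nat) with ((b 0%nat * 0 + a 0%nat * w 1%nat - z * 0) / a 0%nat)%C
    by (field; apply hz).
  rewrite hw; field; apply hz.
- split; trivial.
  specialize (hw (S n)); unfold jshift in hw; simpl in hw; rewrite IH1, IH2 in hw.
  replace (w (S (S n))) with
    ((a n * 0 + b (S n) * 0 + a (S n) * w (S (S n)) - z * 0) / a (S n))%C
    by (field; apply hz).
  rewrite hw; field; apply hz.
Qed.

Lemma jshift_pseq (a b : nat -> R) (ha : forall n, 0 < a n) (z : C) (n : nat) :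
  jshift a b z (pseq a b z) n = 0%C.
Proof.
unfold jshift; destruct n as [|n].
- unfold pseq; simpl; field; intro e; apply RtoC_inj in e; specialize (ha 0%nat); lra.
- pose proof (solution_rec a b ha z 1 ((z - b 0%nat) / a 0%nat) n) as h; cbv zeta in h.
  unfold pseq; cbn [jacobi]; rewrite h; ring.
Qed.

(** In row 0 only [a_0 q_1 = 1] survives: [q] solves the inhomogeneous equation whose right side is
    the first basis vector. *)
Lemma jshift_qseq (a b : nat -> R) (ha : forall n, 0 < a n) (z : C) (n : nat) :
  jshift a b z (qseq a b z) n = match n with O => 1%C | S _ => 0%C end.
Proof.
unfold jshift; destruct n as [|n].
- unfold qseq; simpl; field; intro e; apply RtoC_inj in e; specialize (ha 0%nat); lra.
- pose proof (solution_rec a b ha z 0 (1 / a 0%nat) n) as h; cbv zeta in h.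
  unfold qseq; cbn [jacobi]; rewrite h; ring.
Qed.

(** In [green] for [q] and [p] the terms with [z] cancel, and only row 0 contributes, namely
    [p_0 = 1]. *)
Lemma wronskian (a b : nat -> R) (ha : forall n, 0 < a n) (z : C) (n : nat) :
  (a n * (qseq a b z (S n) * pseq a b z n - qseq a b z n * pseq a b z (S n)) = 1)%C.
Proof.
assert (hj : forall u k, (jacobi a b u k = jshift a b z u k + z * u k)%C).
{ intros u k; unfold jshift; ring. }
rewrite <- (green a b); induction n as [|n IH].
- rewrite sum_n_OC, !hj, jshift_pseq, jshift_qseq by trivial.
  unfold pseq, qseq; simpl; ring.
- rewrite sum_n_SC, IH, !hj, jshift_pseq, jshift_qseq by trivial; ring.
Qed.

Lemma kernel_multiple_of_pseq (a b : nat -> R) (ha : forall n, 0 < a n) (z : C)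
    (u : cseq) :
  (forall n, jshift a b z u n = 0%C) -> forall n, u n = (u 0%nat * pseq a b z n)%C.
Proof.
intros hu n.
enough (h : (1 * u n + (- u 0%nat) * pseq a b z n = 0)%C).
{ rewrite <- (Cplus_0_r (_ * _)), <- h; ring. }
apply (solution_zero a b ha z (fun n => 1 * u n + (- u 0%nat) * pseq a b z n)%C).
- intro k; rewrite jshift_lin, hu, jshift_pseq by trivial; ring.
- unfold pseq; simpl; ring.
Qed.

(** Variation of constants; changing [c] adds multiples of [pseq a b z]. *)
Lemma jshift_particular (a b : nat -> R) (ha : forall n, 0 < a n) (z c : C)
    (h : cseq) (n : nat) :
  jshift a b z (fun n =>
    qseq a b z n * sum_n (fun m => pseq a b z m * h m) n
    + pseq a b z n * (c - sum_n (fun m => qseq a b z m * h m) n))%C n = h n.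
Proof.
set (p := pseq a b z); set (q := qseq a b z).
destruct n as [|n].
- pose proof (jshift_pseq a b ha z 0) as hp; pose proof (jshift_qseq a b ha z 0) as hq.
  fold p in hp; fold q in hq.
  unfold jshift in *; cbn [jacobi] in *; rewrite !sum_n_SC, !sum_n_OC.
  transitivity ((b 0%nat * q 0%nat + a 0%nat * q 1%nat - z * q 0%nat) * (p 0%nat * h 0%nat)
   + (b 0%nat * p 0%nat + a 0%nat * p 1%nat - z * p 0%nat) * (c - q 0%nat * h 0%nat))%C.
  { ring. }
  rewrite hp, hq; unfold p, pseq; simpl; ring.
- pose proof (jshift_pseq a b ha z (S n)) as hp.
  pose proof (jshift_qseq a b ha z (S n)) as hq.
  pose proof (wronskian a b ha z n) as hw.
  fold p q in hw; fold p in hp; fold q in hq.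
  unfold jshift in *; cbn [jacobi] in *; rewrite !sum_n_SC.
  set (A := sum_n (fun m => p m * h m)%C n); set (B := sum_n (fun m => q m * h m)%C n).
  (* Everything is rewritten with the sums up to [S n]. In row [n + 2] the new terms of the two sums
     cancel; the missing terms in row [n] leave the Wronskian times [h (S n)]. *)
  transitivity (
    (a n * q n + b (S n) * q (S n)
      + a (S n) * q (S (S n)) - z * q (S n))
      * (A + p (S n) * h (S n))
   + (a n * p n + b (S n) * p (S n)
      + a (S n) * p (S (S n)) - z * p (S n))
      * (c - B - q (S n) * h (S n))
   + a n * (q (S n) * p n - q n * p (S n)) * h (S n))%C.
  { ring. }
  rewrite hp, hq, hw; ring.
Qed.

(** * Entrywise limits, [jacobi] and the closure of [Jmin] *)

Definition Ccvg (x : nat -> C) (l : C) : Prop :=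
  is_lim_seq (fun k => Cmod (x k - l)%C) 0.

Lemma Ccvg_const (l : C) : Ccvg (fun _ => l) l.
Proof.
apply (is_lim_seq_ext (fun _ => 0)); [|apply is_lim_seq_const].
intros _; replace (l - l)%C with (RtoC 0) by ring; now rewrite Cmod_0.
Qed.

Lemma is_lim_seq_squeeze_0 (x y : nat -> R) :
  (forall k, 0 <= x k <= y k) -> is_lim_seq y 0 -> is_lim_seq x 0.
Proof.
intros h hy; apply (is_lim_seq_le_le (fun _ => 0) x y); trivial.
apply is_lim_seq_const.
Qed.

Lemma is_lim_seq_lin_0 (s t : R) (x y : nat -> R) :
  is_lim_seq x 0 -> is_lim_seq y 0 -> is_lim_seq (fun k => s * x k + t * y k) 0.
Proof.
intros hx hy; replace (Finite 0) with (Finite (s * 0 + t * 0)) by (f_equal; ring).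
apply is_lim_seq_plus'; apply is_lim_seq_mult'; trivial; apply is_lim_seq_const.
Qed.

Lemma Ccvg_lin (c d : C) (x y : nat -> C) (l m : C) :
  Ccvg x l -> Ccvg y m -> Ccvg (fun k => c * x k + d * y k)%C (c * l + d * m)%C.
Proof.
intros hx hy.
apply (is_lim_seq_squeeze_0 _
  (fun k => Cmod c * Cmod (x k - l)%C + Cmod d * Cmod (y k - m)%C)).
- intro k; split; [apply Cmod_ge_0|].
  rewrite <- !Cmod_mult.
  replace (c * x k + d * y k - (c * l + d * m))%C
    with (c * (x k - l) + d * (y k - m))%C by ring.
  apply Cmod_triangle.
- now apply is_lim_seq_lin_0.
Qed.

Lemma Ccvg_unique (x : nat -> C) (l m : C) : Ccvg x l -> Ccvg x m -> l = m.
Proof.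
intros hl hm.
assert (h : Ccvg (fun _ => l - m)%C 0%C).
{ apply (is_lim_seq_squeeze_0 _
    (fun k => 1 * Cmod (x k - l)%C + 1 * Cmod (x k - m)%C)).
  - intro k; split; [apply Cmod_ge_0|].
    rewrite <- (Cmod_opp (x k - l)).
    replace (l - m - 0)%C with (- (x k - l) + (x k - m))%C by ring.
    rewrite !Rmult_1_l; apply Cmod_triangle.
  - now apply is_lim_seq_lin_0. }
assert (h0 : Cmod (l - m - 0)%C = 0).
{ change (is_lim_seq (fun _ => Cmod (l - m - 0)%C) 0) in h.
  pose proof (is_lim_seq_unique _ _ h) as h1; rewrite Lim_seq_const in h1.
  now injection h1. }
apply Cmod_eq_0 in h0.
rewrite <- (Cplus_0_r m), <- h0; ring.
Qed.

Lemma Ccvg_ext (x y : nat -> C) (l : C) :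
  (forall k, x k = y k) -> Ccvg x l -> Ccvg y l.
Proof. intros h; apply is_lim_seq_ext; intro k; now rewrite h. Qed.

Lemma Ccvg_jacobi (a b : nat -> R) (f : nat -> cseq) (u : cseq) :
  (forall n, Ccvg (fun k => f k n) (u n)) ->
  forall n, Ccvg (fun k => jacobi a b (f k) n) (jacobi a b u n).
Proof.
intros h [|n].
- exact (Ccvg_lin _ _ _ _ _ _ (h 0%nat) (h 1%nat)).
- apply (Ccvg_ext (fun k => 1 * (a n * f k n + b (S n) * f k (S n))
    + a (S n) * f k (S (S n)))%C); [intro k; simpl; ring|].
  replace (jacobi a b u (S n)) with (1 * (a n * u n + b (S n) * u (S n))
    + a (S n) * u (S (S n)))%C by (simpl; ring).
  apply Ccvg_lin; [apply Ccvg_lin|]; apply h.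
Qed.

Lemma ell2_cvg_normsq_0 (f : nat -> cseq) (u : cseq) :
  ell2_cvg f u -> is_lim_seq (fun k => normsq (fun n => f k n - u n)%C) 0.
Proof.
intros [hf [hu hl]].
apply (is_lim_seq_ext (fun k => ell2_norm (fun n => f k n - u n)%C
  * ell2_norm (fun n => f k n - u n)%C)).
- intro k; apply sqrt_sqrt; apply normsq_ge_0; now apply ell2_minus.
- replace (Finite 0) with (Finite (0 * 0)) by (f_equal; ring).
  now apply is_lim_seq_mult'.
Qed.

Lemma ell2_cvg_lin (c d : C) (f g : nat -> cseq) (u v : cseq) :
  ell2_cvg f u -> ell2_cvg g v ->
  ell2_cvg (fun k n => c * f k n + d * g k n)%C (fun n => c * u n + d * v n)%C.
Proof.
intros hf hg.
pose proof (ell2_cvg_normsq_0 _ _ hf) as lf.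
pose proof (ell2_cvg_normsq_0 _ _ hg) as lg.
destruct hf as [hf [hu _]]; destruct hg as [hg [hv _]].
assert (hfu := fun k => ell2_minus _ _ (hf k) hu).
assert (hgv := fun k => ell2_minus _ _ (hg k) hv).
apply ell2_cvg_normsq.
- intro k; now apply ell2_lin.
- now apply ell2_lin.
- apply (is_lim_seq_squeeze_0 _
    (fun k => (2 * Cmod c ^ 2) * normsq (fun n => f k n - u n)%C
            + (2 * Cmod d ^ 2) * normsq (fun n => g k n - v n)%C)).
  2: now apply is_lim_seq_lin_0.
  intro k; split.
  + now apply normsq_ge_0, ell2_minus; apply ell2_lin.
  + rewrite (normsq_ext _ (fun n => c * (f k n - u n) + d * (g k n - v n))%C)
      by (intro n; ring).
    rewrite !Rmult_assoc, <- !normsq_scal.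
    now apply normsq_plus_le; apply ell2_scal.
Qed.

Lemma ell2_cvg_ext (f g : nat -> cseq) (u v : cseq) :
  (forall k n, f k n = g k n) -> (forall n, u n = v n) ->
  ell2_cvg f u -> ell2_cvg g v.
Proof.
intros hfg huv hc; pose proof (ell2_cvg_normsq_0 _ _ hc) as hl.
destruct hc as [hf [hu _]]; apply ell2_cvg_normsq.
- intro k; now apply (ell2_ext (f k)).
- now apply (ell2_ext u).
- revert hl; apply is_lim_seq_ext; intro k; apply normsq_ext; intro n.
  now rewrite hfg, huv.
Qed.

(** Convergence in [ell2] is entrywise, and an entry of [jacobi a b u] involves at most three
    entries of [u]; so the limit of the images is the image of the limit. *)
Lemma clos_Jmin_sub_Jmax (a b : nat -> R) (u v : cseq) :
  clos (Jmin a b) u v -> Jmax a b u v.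
Proof.
intros [f [g [hT [hf hg]]]].
assert (e : v = jacobi a b u).
{ apply functional_extensionality; intro n.
  apply (Ccvg_unique (fun k => g k n)).
  - exact (ell2_cvg_pointwise g v n hg).
  - apply (Ccvg_ext (fun k => jacobi a b (f k) n)).
    + intro k; now rewrite (proj2 (hT k)).
    + apply Ccvg_jacobi; intro m; exact (ell2_cvg_pointwise f u m hf). }
destruct hf as [_ [hu _]]; destruct hg as [_ [hv _]].
split; trivial; split; trivial; now rewrite <- e.
Qed.

Lemma jshift_finitely_supported (a b : nat -> R) (z : C) (u : cseq) :
  finitely_supported u -> finitely_supported (jshift a b z u).
Proof.
intro hu; destruct (jacobi_finitely_supported a b u hu) as [M hM].
destruct hu as [N hN]; exists (Nat.max M N); intros n hn.
unfold jshift; rewrite hM, hN by lia; ring.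
Qed.

(** Taking imaginary parts in [<(J - i) v, v>] bounds [|v|^2] by
    [|(J - i) v| |v|]. *)
Lemma normsq_le_jshift_Ci (a b : nat -> R) (v : cseq) :
  finitely_supported v -> normsq v <= normsq (jshift a b Ci v).
Proof.
intro hv.
assert (hg := finitely_supported_ell2 _ (jshift_finitely_supported a b Ci v hv)).
assert (h2 := finitely_supported_ell2 _ hv).
destruct hv as [N hN].
apply (is_lim_seq_le_loc (sum_n (fun k => Cmod (v k) ^ 2))
  (fun _ => normsq (jshift a b Ci v)) (normsq v) (normsq (jshift a b Ci v))).
2: exact (Series_correct _ h2).
2: apply is_lim_seq_const.
exists N; intros n hn.
pose proof (jshift_Ci_form a b v n) as h.
rewrite (hN n hn), (hN (S n)) in h by lia.
replace (Im (0 * Cconj 0)) with 0 in h by (simpl; ring).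
pose proof (partial_sum_le_normsq _ n hg) as h3.
(* With [S] the sum of [|v_k|^2] and [G] that of [|(J - i) v|^2], the form identity reads
   [S = - sum Im]. The claim thus says [2 S <= G + S], whence [S <= G]. *)
enough (h4 : - 2 * sum_n (fun k => Im (jshift a b Ci v k * Cconj (v k))) n
  <= sum_n (fun k => Cmod (jshift a b Ci v k) ^ 2) n + sum_n (fun k => Cmod (v k) ^ 2) n)
  by lra.
clear - v.
assert (h : forall x y : C, - 2 * Im (x * Cconj y) <= Cmod x ^ 2 + Cmod y ^ 2).
{ intros [x1 x2] [y1 y2]; rewrite !Cmod2_alt; simpl.
  pose proof (pow2_ge_0 (x1 - y2)); pose proof (pow2_ge_0 (x2 + y1)); nra. }
induction n as [|n IH].
- rewrite !sum_n_OR; apply h.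
- rewrite !sum_n_SR; specialize (h (jshift a b Ci v (S n)) (v (S n))); lra.
Qed.

Lemma is_series_finite (f : nat -> R) (M : nat) :
  (forall m, (M < m)%nat -> f m = 0) -> is_series f (sum_n f M).
Proof.
intro h; change (is_lim_seq (sum_n f) (sum_n f M)).
apply (is_lim_seq_ext_loc (fun _ => sum_n f M)); [|apply is_lim_seq_const].
exists M; intros n hn; induction hn as [|n hn IH]; trivial.
rewrite sum_n_SR, <- IH, h by lia; symmetry; apply Rplus_0_r.
Qed.

(** Finite support of [g] makes the cross term a finite sum, so that it later follows entrywise
    limits of [x]. *)
Lemma normsq_expand (x g : cseq) (s : R) (M : nat) :
  ell2 x -> (forall m, (M < m)%nat -> g m = 0%C) ->
  normsq (fun m => x m + s * g m)%C
  = normsq x + 2 * s * sum_n (fun m => Re (x m * Cconj (g m))) M + s ^ 2 * normsq g.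
Proof.
intros hx hg.
assert (hg2 : ell2 g).
{ apply finitely_supported_ell2; exists (S M); intros m hm; apply hg; lia. }
assert (hr : is_series (fun m => Re (x m * Cconj (g m)))
  (sum_n (fun m => Re (x m * Cconj (g m))) M)).
{ apply is_series_finite; intros m hm; rewrite hg by trivial; simpl; ring. }
assert (h1 : ex_series (fun m => 2 * s * Re (x m * Cconj (g m)))).
{ apply (ex_series_scal_l (K := R_AbsRing) (V := R_NormedModule)); eexists; exact hr. }
assert (h2 := ex_series_scal_l (K := R_AbsRing) (V := R_NormedModule) (s ^ 2) _ hg2).
rewrite <- (is_series_unique _ _ hr); unfold normsq.
rewrite <- !Series_scal_l, <- !Series_plus; trivial.
- apply Series_ext; intro m; rewrite !Cmod2_alt; unfold Re, Im; simpl; ring.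
- exact (ex_series_plus (K := R_AbsRing) (V := R_NormedModule) _ _ hx h1).
Qed.

Lemma sum_n_delta (f : nat -> C) (n M : nat) :
  (n <= M)%nat ->
  sum_n (fun m => if Nat.eqb m n then f m else RtoC 0) M = f n.
Proof.
assert (h0 : forall k, (k < n)%nat ->
  sum_n (fun m => if Nat.eqb m n then f m else RtoC 0) k = RtoC 0).
{ induction k as [|k IH]; intro hk.
  - rewrite sum_n_OC; destruct (Nat.eqb_spec 0 n); [lia|reflexivity].
  - rewrite sum_n_SC, IH by lia.
    destruct (Nat.eqb_spec (S k) n); [lia|apply Cplus_0_l]. }
induction M as [|M IH]; intro hn.
- rewrite sum_n_OC; replace n with 0%nat by lia; reflexivity.
- rewrite sum_n_SC; destruct (Nat.eqb_spec (S M) n) as [e|e].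
  + rewrite h0 by lia; subst n; apply Cplus_0_l.
  + rewrite IH by lia; apply Cplus_0_r.
Qed.

Lemma sum_n_Re (f : nat -> C) (n : nat) :
  sum_n (fun k => Re (f k)) n = Re (sum_n f n).
Proof.
induction n as [|n IH].
- now rewrite sum_n_OR, sum_n_OC.
- now rewrite sum_n_SR, sum_n_SC, IH.
Qed.

Lemma is_lim_seq_Re (x : nat -> C) (l : C) :
  Ccvg x l -> is_lim_seq (fun k => Re (x k)) (Re l).
Proof.
intro h; apply is_lim_seq_spec; intro eps.
apply is_lim_seq_spec in h; destruct (h eps) as [N hN].
exists N; intros k hk; specialize (hN k hk).
rewrite Rminus_0_r, Rabs_pos_eq in hN by apply Cmod_ge_0.
eapply Rle_lt_trans; [|apply hN].
exact (re_le_Cmod (x k - l)%C).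
Qed.

Lemma Ccvg_sum_n (x : nat -> cseq) (l g : cseq) (M : nat) :
  (forall m, Ccvg (fun k => x k m) (l m)) ->
  Ccvg (fun k => sum_n (fun m => x k m * g m)%C M) (sum_n (fun m => l m * g m)%C M).
Proof.
intro h; induction M as [|M IH].
- apply (Ccvg_ext (fun k => g 0%nat * x k 0%nat + 0 * x k 0%nat)%C).
  + intro k; rewrite sum_n_OC; ring.
  + rewrite sum_n_OC; replace (l 0%nat * g 0%nat)%C
      with (g 0%nat * l 0%nat + 0 * l 0%nat)%C by ring.
    now apply Ccvg_lin.
- apply (Ccvg_ext (fun k => 1 * sum_n (fun m => x k m * g m)%C M + g (S M) * x k (S M))%C).
  + intro k; rewrite sum_n_SC; ring.
  + rewrite sum_n_SC; replace (_ + _)%C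
      with (1 * sum_n (fun m => l m * g m)%C M + g (S M) * l (S M))%C by ring.
    now apply Ccvg_lin.
Qed.

Lemma finitely_supported_lin (c d : C) (u v : cseq) :
  finitely_supported u -> finitely_supported v ->
  finitely_supported (fun n => c * u n + d * v n)%C.
Proof.
intros [N hN] [M hM]; exists (Nat.max N M); intros n hn.
rewrite hN, hM by lia; ring.
Qed.

(** * A least squares problem *)

Lemma nonneg_parabola (s0 t : R) :
  (forall s, 0 <= 2 * s * s0 + s ^ 2 * t) -> 0 <= t -> s0 = 0.
Proof.
(* This is the minimiser [- s0 / t] with [t + 1] in place of [t], which keeps the denominator
   positive when [t = 0]; the value is still negative unless [s0 = 0]. *)
intros h ht; specialize (h (- s0 / (t + 1))).
replace (2 * (- s0 / (t + 1)) * s0 + (- s0 / (t + 1)) ^ 2 * t)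
  with (- (s0 ^ 2 * (t + 2) / (t + 1) ^ 2)) in h by (field; lra).
assert (h1 : 0 < (t + 2) / (t + 1) ^ 2) by (apply Rdiv_lt_0_compat; nra).
assert (h2 : s0 ^ 2 * ((t + 2) / (t + 1) ^ 2) <= 0) by (unfold Rdiv in *; lra).
apply NNPP; intro e; pose proof (pow2_gt_0 s0 e); nra.
Qed.

Definition defect (a b : nat -> R) (f v : cseq) : cseq :=
  fun n => (jshift a b Ci v n - f n)%C.

Lemma defect_inf (a b : nat -> R) (f : cseq) : ell2 f ->
  exists d, (forall v, finitely_supported v -> d <= normsq (defect a b f v)) /\
    forall eps, 0 < eps -> exists v, finitely_supported v /\
      normsq (defect a b f v) < d + eps.
Proof.
intro hf.
(* [completeness] yields suprema, so the infimum [d] is obtained as minus the supremum of the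
   negated values. *)
destruct (completeness (fun r => exists v, finitely_supported v /\
  r = - normsq (defect a b f v))) as [m [hm1 hm2]].
- exists 0; intros r [v [hv ->]].
  enough (0 <= normsq (defect a b f v)) by lra.
  apply normsq_ge_0, ell2_minus; trivial.
  now apply finitely_supported_ell2, jshift_finitely_supported.
- exists (- normsq (defect a b f (fun _ => RtoC 0))), (fun _ => RtoC 0); split; trivial.
  now exists 0%nat.
- exists (- m); split.
  + intros v hv.
    enough (- normsq (defect a b f v) <= m) by lra.
    apply hm1; now exists v.
  + intros eps he; apply NNPP; intro h.
    enough (m <= m - eps) by lra.
    apply hm2; intros r [v [hv ->]].
    apply Rnot_lt_le; intro h1; apply h; exists v; split; trivial; lra.
Qed.

(** The residual of the least squares problem for [(J - i) v = f] over finitely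
    supported [v] is orthogonal to the range, i.e. it is killed by [J + i]. *)
Lemma least_squares (a b : nat -> R) (f : cseq) : ell2 f ->
  exists (v : nat -> cseq) (t : cseq),
    (forall k, finitely_supported (v k)) /\ ell2_cvg v t /\
    ell2_cvg (fun k => jshift a b Ci (v k)) (jshift a b Ci t) /\
    forall n, jshift a b (- Ci) (defect a b f t) n = 0%C.
Proof.
intro hf.
destruct (defect_inf a b f hf) as [d [hd hinf]].
assert (hS : forall k, 0 < / INR (S k)).
{ intro k; apply Rinv_0_lt_compat, lt_0_INR; lia. }
pose (V := fun k => constructive_indefinite_description _ (hinf (/ INR (S k)) (hS k))).
pose (v := fun k => proj1_sig (V k)).
assert (hv : forall k, finitely_supported (v k)) by (intro k; exact (proj1 (proj2_sig (V k)))).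
assert (hvd : forall k, normsq (defect a b f (v k)) < d + / INR (S k))
  by (intro k; exact (proj2 (proj2_sig (V k)))).
clearbody v; clear V hinf.
pose (x := fun k => defect a b f (v k)).
assert (hx : forall k, ell2 (x k)).
{ intro k; apply ell2_minus; trivial.
  now apply finitely_supported_ell2, jshift_finitely_supported. }
(* The midpoint of [v k] and [v l] is again finitely supported, and its defect is half of
   [x k + x l], hence has [normsq] at least [d]. In the parallelogram law the multiples of [d] then
   cancel. *)
assert (hcauchy : forall k l,
  normsq (fun n => x k n - x l n)%C <= 2 * / INR (S k) + 2 * / INR (S l)).
{ intros k l.
  pose proof (normsq_parallelogram _ _ (hx k) (hx l)) as h.
  rewrite (normsq_ext (fun n => x k n + x l n)%C
    (fun n => 2 * defect a b f (fun m => / 2 * v k m + / 2 * v l m) n)%C) in h.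
  - rewrite normsq_scal, Cmod_R, Rabs_pos_eq in h by lra.
    pose proof (hd _ (finitely_supported_lin (/ 2) (/ 2) _ _ (hv k) (hv l))) as h1.
    pose proof (hvd k); pose proof (hvd l); unfold x in *; lra.
  - intro n; unfold x, defect; rewrite jshift_lin.
    field; intro e; apply RtoC_inj in e; lra. }
assert (hsmall : forall eps, 0 < eps -> exists N, forall k l, (N <= k)%nat -> (N <= l)%nat ->
  2 * / INR (S k) + 2 * / INR (S l) <= eps).
{ intros eps he; destruct (archimed_cor1 (eps / 4)) as [N [hN hN0]]; [lra|].
  exists N.
  assert (h : forall k, (N <= k)%nat -> / INR (S k) <= / INR N).
  { intros k hk; apply Rinv_le_contravar; [now apply lt_0_INR|apply le_INR; lia]. }
  intros k l hk hl; pose proof (h k hk); pose proof (h l hl); lra. }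
assert (hvl : forall k, ell2 (v k)) by (intro k; now apply finitely_supported_ell2).
destruct (ell2_complete x hx) as [y hy].
{ intros eps he; destruct (hsmall eps he) as [N hN]; exists N; intros k l hk hl.
  exact (Rle_trans _ _ _ (hcauchy k l) (hN k l hk hl)). }
(* In [x k - x l] the datum [f] cancels, leaving [J - i] applied to [v k - v l]; the lower bound for
   [J - i] makes [v] Cauchy at the same rate. *)
destruct (ell2_complete v hvl) as [t ht].
{ intros eps he; destruct (hsmall eps he) as [N hN]; exists N; intros k l hk hl.
  refine (Rle_trans _ _ _ _ (Rle_trans _ _ _ (hcauchy k l) (hN k l hk hl))).
  rewrite (normsq_ext _ (fun n => 1 * v k n + (- (1)) * v l n)%C) by (intro n; ring).
  eapply Rle_trans; [apply (normsq_le_jshift_Ci a b), finitely_supported_lin; apply hv|].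
  right; apply normsq_ext; intro n; unfold x, defect; rewrite jshift_lin; ring. }
assert (hyn : forall n, y n = defect a b f t n).
{ intro n; apply (Ccvg_unique (fun k => x k n)).
  - exact (ell2_cvg_pointwise _ _ n hy).
  - apply (Ccvg_ext (fun k => 1 * jacobi a b (v k) n
      + 1 * ((- Ci) * v k n + (- (1)) * f n))%C).
    + intro k; unfold x, defect, jshift; ring.
    + replace (defect a b f t n) with (1 * jacobi a b t n
        + 1 * ((- Ci) * t n + (- (1)) * f n))%C by (unfold defect, jshift; ring).
      apply Ccvg_lin.
      * apply Ccvg_jacobi; intro m; exact (ell2_cvg_pointwise _ _ m ht).
      * apply Ccvg_lin; [exact (ell2_cvg_pointwise _ _ n ht)|apply Ccvg_const]. }
exists v, t; split; [trivial|split; [trivial|split]].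
- pose proof (ell2_cvg_lin 1 1 x (fun _ => f) y f hy) as h.
  assert (hff : ell2_cvg (fun _ => f) f).
  { apply ell2_cvg_normsq; trivial.
    apply (is_lim_seq_ext (fun _ => 0)); [|apply is_lim_seq_const].
    intros _; rewrite (normsq_ext _ (fun n => 0 * f n)%C) by (intro n; ring).
    rewrite normsq_scal, Cmod_0; ring. }
  apply (fun e1 e2 => ell2_cvg_ext _ _ _ _ e1 e2 (h hff)).
  + intros k n; unfold x, defect; ring.
  + intro n; rewrite hyn; unfold defect; ring.
- intro n.
  assert (hres : jshift a b (- Ci) y n = 0%C).
  2: { rewrite <- hres; apply jshift_ext; intro m; now rewrite hyn. }
  set (r := jshift a b (- Ci) y n).
  (* The test vector is the [n]-th basis vector scaled by the entry [r] that has to vanish: its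
     pairing with [y] becomes [|r|^2], which is real, so real variations [s] suffice. *)
  pose (w := fun m => if Nat.eqb m n then r else RtoC 0).
  assert (hw0 : forall m, (m <> n) -> w m = 0%C).
  { intros m hm; unfold w; destruct (Nat.eqb_spec m n); [contradiction|reflexivity]. }
  assert (hw : finitely_supported w).
  { exists (S n); intros m hm; apply hw0; lia. }
  pose (g := jshift a b Ci w).
  assert (hg : forall m, (S n < m)%nat -> g m = 0%C).
  { intros [|m] hm; [lia|]; unfold g, jshift; simpl; rewrite !hw0 by lia; ring. }
  pose (rho := (fun u => sum_n (fun m => u m * Cconj (g m))%C (S n)) : cseq -> C).
  (* First variation: [v k + s w] is a competitor, so [d] is at most the expanded square of
     [x k + s g], while [normsq (x k)] is below [d + / INR (S k)]. *)
  assert (hq : forall k s, - / INR (S k) <= 2 * s * Re (rho (x k)) + s ^ 2 * normsq g).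
  { intros k s.
    pose proof (normsq_expand (x k) g s (S n) (hx k) hg) as h.
    rewrite sum_n_Re in h; fold (rho (x k)) in h.
    pose proof (hd _ (finitely_supported_lin 1 s _ _ (hv k) hw)) as h1.
    rewrite (normsq_ext _ (fun m => x k m + s * g m)%C) in h1.
    - specialize (hvd k); unfold x in *; lra.
    - intro m; unfold defect; rewrite jshift_lin; unfold g, x, defect; ring. }
  assert (hrho : Re (rho y) = 0).
  { apply (nonneg_parabola _ (normsq g)).
    2: { apply normsq_ge_0, finitely_supported_ell2.
         exists (S (S n)); intros m hm; apply hg; lia. }
    intro s.
    apply (is_lim_seq_le (fun k => - / INR (S k))
      (fun k => 2 * s * Re (rho (x k)) + s ^ 2 * normsq g) 0
      (2 * s * Re (rho y) + s ^ 2 * normsq g)).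
    - intro k; apply hq.
    - replace (Finite 0) with (Rbar_opp (Finite 0)) by (simpl; f_equal; ring).
      apply -> is_lim_seq_opp.
      apply (is_lim_seq_incr_1 (fun k => / INR k)).
      apply (is_lim_seq_inv INR p_infty); [apply is_lim_seq_INR|discriminate].
    - apply is_lim_seq_plus'; [|apply is_lim_seq_const].
      apply is_lim_seq_mult'; [apply is_lim_seq_const|].
      apply is_lim_seq_Re, Ccvg_sum_n; intro m; exact (ell2_cvg_pointwise _ _ m hy). }
  (* Green's identity moves [J] from [w] to [y], and conjugation turns [- i] into [+ i]. The
     boundary term at [S n] vanishes because [w] lives at [n] only. *)
  assert (e : rho y = (r * Cconj r)%C).
  { pose proof (green a b y (fun m => Cconj (w m)) (S n)) as h.
    cbv beta in h; rewrite (hw0 (S n)), (hw0 (S (S n))) in h by lia.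
    replace (Cconj 0) with (RtoC 0) in h by (symmetry; apply Cconj_R).
    pose proof (sum_n_delta (fun m => jshift a b (- Ci) y m * Cconj r)%C n (S n)
      (Nat.le_succ_diag_r n)) as h1.
    cbv beta in h1; fold r in h1; rewrite <- h1.
    transitivity (rho y + sum_n (fun k => jacobi a b y k * Cconj (w k)
       - y k * jacobi a b (fun m => Cconj (w m)) k) (S n))%C.
    { rewrite h; ring. }
    clear h h1; unfold rho; generalize (S n) as M; intro M.
    rewrite <- (sum_n_plus (G := C_AbelianMonoid)).
    apply sum_n_ext; intro m; rewrite jacobi_conj.
    match goal with |- ?l = ?r => change (@eq C l r) end.
    change (plus (G := C_AbelianMonoid)) with Cplus.
    transitivity (jshift a b (- Ci) y m * Cconj (w m))%C.
    - unfold g, jshift; rewrite Cminus_conj, Cmult_conj.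
      replace (Cconj Ci) with (- Ci)%C by (unfold Cconj, Ci, Copp; simpl; f_equal; ring).
      ring.
    - unfold w; destruct (Nat.eqb m n); trivial.
      rewrite Cconj_R; ring. }
  rewrite e, <- Cmod2_conj in hrho.
  apply Cmod_eq_0; simpl in hrho; nra.
Qed.

(** * The limit circle hypothesis puts [p(i)] in [ell2] *)

(** The kernel is spanned by [p(i)]: if [u 0] were nonzero, dividing [u] by it would put [p(i)] in
    [ell2]. *)
Lemma ell2_kernel_Ci_trivial (a b : nat -> R) (ha : forall n, 0 < a n) (u : cseq) :
  ell2 u -> (forall n, jshift a b Ci u n = 0%C) ->
  ~ ell2 (pseq a b Ci) -> forall n, u n = 0%C.
Proof.
intros hu h hp n.
pose proof (kernel_multiple_of_pseq a b ha Ci u h) as hk.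
destruct (classic (u 0%nat = 0%C)) as [e|e].
- rewrite hk, e; ring.
- destruct hp; apply (ell2_ext (fun n => / u 0%nat * u n)%C).
  + intro m; rewrite (hk m); field; trivial.
  + now apply ell2_scal.
Qed.

Lemma limit_circle_pseq_Ci (a b : nat -> R) (ha : forall n, 0 < a n) :
  ~ op_eq (clos (Jmin a b)) (Jmax a b) -> ell2 (pseq a b Ci).
Proof.
intro hlc; apply NNPP; intro hp; apply hlc.
intros u w; split; [apply clos_Jmin_sub_Jmax|].
intros [[hu hJu] ->].
assert (hf : ell2 (jshift a b Ci u)) by (apply ell2_minus; trivial; now apply ell2_scal).
destruct (least_squares a b _ hf) as [v [t [hv [hvt [hJt hres]]]]].
set (y := defect a b (jshift a b Ci u) t) in *.
assert (ht : ell2 t) by apply hvt.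
(* The residual solves the equation at [- i]; its conjugate solves the one at [i], where the
   hypothesis on [p(i)] applies. *)
assert (hy0 : forall n, Cconj (y n) = 0%C).
{ apply (ell2_kernel_Ci_trivial a b ha); trivial.
  - apply ell2_conj, ell2_minus; trivial; apply hJt.
  - intro n; rewrite <- (Cconj_R 0), <- (hres n); unfold jshift.
    rewrite jacobi_conj, Cminus_conj, Cmult_conj.
    replace (Cconj (- Ci)) with Ci by (unfold Cconj, Ci, Copp; simpl; f_equal; ring).
    reflexivity. }
assert (htu : forall n, (t n - u n = 0)%C).
{ apply (ell2_kernel_Ci_trivial a b ha); trivial.
  - now apply ell2_minus.
  - intro n; transitivity (jshift a b Ci (fun m => 1 * t m + (- (1)) * u m)%C n).
    + apply jshift_ext; intro m; ring.
    + rewrite jshift_lin; transitivity (y n); [unfold y, defect; ring|].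
      rewrite <- (Cconj_conj (y n)), hy0; apply Cconj_R. }
assert (etu : forall n, t n = u n).
{ intro n; rewrite <- (Cplus_0_r (u n)), <- (htu n); ring. }
exists v, (fun k => jacobi a b (v k)); split; [|split].
- intro k; split; trivial.
- revert hvt; apply ell2_cvg_ext; trivial.
(* The images converge because [J v_k = (J - i) v_k + i v_k] and both summands do. *)
- apply (ell2_cvg_ext _ _ _ _ (fun _ _ => eq_refl) (jacobi_ext a b t u etu)).
  apply (fun e1 e2 => ell2_cvg_ext _ _ _ _ e1 e2 (ell2_cvg_lin 1 Ci _ _ _ _ hJt hvt)).
  + intros k n; unfold jshift; ring.
  + intros n; unfold jshift; ring.
Qed.

(** * Square-summability of all solutions *)

(** A zero at [S n] would make the non-real number [i] an eigenvalue of a truncated real symmetric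
    matrix: the form identity would give a zero sum of [|p_k|^2], although [p_0 = 1]. *)
Lemma pseq_Ci_ne_0 (a b : nat -> R) (ha : forall n, 0 < a n) (n : nat) :
  pseq a b Ci n <> 0%C.
Proof.
destruct n as [|n].
- unfold pseq; simpl; intro e; apply RtoC_inj in e; lra.
- intro e; pose proof (jshift_Ci_form a b (pseq a b Ci) n) as h.
  rewrite e in h.
  replace (Im (0 * _)) with 0 in h by (simpl; ring).
  rewrite (sum_n_ext _ (fun _ => 0)) in h.
  2: { intro k; rewrite jshift_pseq by trivial; simpl; ring. }
  rewrite sum_n_const in h.
  pose proof (term_le_sum_n (fun k => Cmod (pseq a b Ci k) ^ 2) 0 n
    (fun k => pow2_ge_0 _) (Nat.le_0_l n)) as h1.
  cbv beta in h1; change (pseq a b Ci 0%nat) with (RtoC 1) in h1.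
  rewrite Cmod_1 in h1; rewrite Rmult_0_r in h; lra.
Qed.

(** [u = q - (q_N / p_N) p] solves a truncated problem [(J_N - i) u = e_0], so
    [|u_0| = |q_N / p_N| <= 1]. *)
Lemma Cmod_qseq_le_pseq_Ci (a b : nat -> R) (ha : forall n, 0 < a n) (n : nat) :
  Cmod (qseq a b Ci n) <= Cmod (pseq a b Ci n).
Proof.
destruct n as [|n].
- unfold qseq; simpl; rewrite Cmod_0; apply Cmod_ge_0.
- pose proof (pseq_Ci_ne_0 a b ha (S n)) as hp.
  set (m := (- (qseq a b Ci (S n) / pseq a b Ci (S n)))%C).
  enough (h : Cmod m <= 1).
  { replace (qseq a b Ci (S n)) with (- m * pseq a b Ci (S n))%C
      by (unfold m; field; trivial).
    rewrite Cmod_mult, Cmod_opp.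
    pose proof (Cmod_ge_0 (pseq a b Ci (S n))); nra. }
  pose (u := fun k => (1 * qseq a b Ci k + m * pseq a b Ci k)%C).
  assert (hu0 : u 0%nat = m) by (unfold u, qseq, pseq; simpl; ring).
  assert (hun : u (S n) = 0%C) by (unfold u, m; field; trivial).
  pose proof (jshift_Ci_form a b u n) as h; rewrite hun in h.
  replace (Im (0 * _)) with 0 in h by (simpl; ring).
  assert (hs : forall k, sum_n (fun k => Im (jshift a b Ci u k * Cconj (u k))) k
    = - Im m).
  { assert (h1 : forall k, jshift a b Ci u k = match k with O => 1%C | S _ => 0%C end).
    { intro k; unfold u; rewrite jshift_lin, jshift_pseq, jshift_qseq by trivial.
      destruct k; ring. }
    induction k as [|k IH].
    - rewrite sum_n_OR, h1, hu0; destruct m; simpl; ring.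
    - rewrite sum_n_SR, IH, h1; unfold Im; simpl; ring. }
  (* Now [sum |u_k|^2 = Im m], and the term [k = 0] is [|m|^2]; so [|m|^2 <= Im m <= |m|]. *)
  rewrite hs in h.
  assert (h2 : Cmod m ^ 2 <= sum_n (fun k => Cmod (u k) ^ 2) n).
  { rewrite <- hu0; apply (term_le_sum_n (fun k => Cmod (u k) ^ 2)); [|lia].
    intro k; apply pow2_ge_0. }
  assert (h3 : Rabs (Im m) <= Cmod m) by exact (Rle_trans _ _ _ (Rmax_r _ _) (Rmax_Cmod m)).
  pose proof (Rle_abs (Im m)); pose proof (Cmod_ge_0 m); nra.
Qed.

(** The equation at [z] is read as one at [z0] with the extra right side [(z - z0) u]. Since
    [q_0 = 0] and [p_0 = 1], the constant [u 0] makes both sides agree at index 0, and uniqueness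
    applies. *)
Lemma variation_of_constants (a b : nat -> R) (ha : forall n, 0 < a n)
    (z0 z c : C) (u : cseq) :
  (forall n, jshift a b z u n = match n with O => c | S _ => 0%C end) ->
  forall n, u n =
    (c * qseq a b z0 n
     + (qseq a b z0 n * sum_n (fun m => pseq a b z0 m * ((z - z0) * u m)) n
        + pseq a b z0 n
          * (u 0%nat - sum_n (fun m => qseq a b z0 m * ((z - z0) * u m)) n)))%C.
Proof.
intros hu n.
set (g := (fun n => qseq a b z0 n * sum_n (fun m => pseq a b z0 m * ((z - z0) * u m)) n
        + pseq a b z0 n
          * (u 0%nat - sum_n (fun m => qseq a b z0 m * ((z - z0) * u m)) n))%C : cseq).
change (u n = c * qseq a b z0 n + g n)%C.
enough (h : (1 * (1 * u n + (- c) * qseq a b z0 n) + (- (1)) * g n = 0)%C).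
{ rewrite <- (Cplus_0_r (_ + _)), <- h; ring. }
apply (solution_zero a b ha z0
  (fun n => 1 * (1 * u n + (- c) * qseq a b z0 n) + (- (1)) * g n)%C).
- intro k; rewrite !jshift_lin, jshift_qseq by trivial.
  unfold g; rewrite (jshift_particular a b ha z0 (u 0%nat) (fun m => (z - z0) * u m)%C).
  replace (jshift a b z0 u k) with (jshift a b z u k + (z - z0) * u k)%C
    by (unfold jshift; ring).
  rewrite hu; destruct k; ring.
- unfold g; rewrite !sum_n_OC; unfold pseq, qseq; simpl; ring.
Qed.

(** Each factor satisfies [1 + y <= exp y]. The exponent also contains [K * w 0], which only
    enlarges the bound. *)
Lemma discrete_gronwall (x w : nat -> R) (K : R) :
  0 <= K -> (forall n, 0 <= w n) -> 0 <= x 0%nat ->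
  (forall n, x (S n) <= x n * (1 + K * w (S n))) ->
  forall n, x n <= x 0%nat * exp (K * sum_n w n).
Proof.
intros hK hw h0 h n; induction n as [|n IH].
- rewrite sum_n_OR.
  pose proof (exp_ineq1_le (K * w 0%nat)); pose proof (hw 0%nat).
  assert (0 <= K * w 0%nat) by now apply Rmult_le_pos.
  nra.
- rewrite sum_n_SR, Rmult_plus_distr_l, exp_plus, <- Rmult_assoc.
  eapply Rle_trans; [apply h|].
  assert (h1 : 0 <= K * w (S n)) by now apply Rmult_le_pos.
  apply Rle_trans with (x 0%nat * exp (K * sum_n w n) * (1 + K * w (S n))).
  + apply Rmult_le_compat_r; lra.
  + apply Rmult_le_compat_l; [|apply exp_ineq1_le].
    apply Rmult_le_pos; [trivial|apply Rlt_le, exp_pos].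
Qed.

Lemma Cmod_sum_n_mult_le (g x : cseq) (G : nat -> R) (w : C) (n : nat) :
  (forall m, Cmod (g m) <= G m) ->
  Cmod (sum_n (fun m => g m * (w * x m))%C n) <= Cmod w * sum_n (fun m => G m * Cmod (x m)) n.
Proof.
intro h; eapply Rle_trans; [apply Cmod_sum_n_le|].
induction n as [|n IH].
- rewrite !sum_n_OR, !Cmod_mult.
  pose proof (Rmult_le_compat_r _ _ _
    (Rmult_le_pos _ _ (Cmod_ge_0 w) (Cmod_ge_0 (x 0%nat))) (h 0%nat)).
  lra.
- rewrite !sum_n_SR, !Cmod_mult.
  pose proof (Rmult_le_compat_r _ _ _
    (Rmult_le_pos _ _ (Cmod_ge_0 w) (Cmod_ge_0 (x (S n)))) (h (S n))).
  lra.
Qed.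

Lemma ell2_solution_transfer (a b : nat -> R) (ha : forall n, 0 < a n)
    (z0 z c : C) (u : cseq) :
  ell2 (pseq a b z0) -> ell2 (qseq a b z0) ->
  (forall n, jshift a b z u n = match n with O => c | S _ => 0%C end) -> ell2 u.
Proof.
intros hp hq hu.
pose (G := fun n => Cmod (pseq a b z0 n) + Cmod (qseq a b z0 n)).
assert (hG0 : forall n, 0 <= G n).
{ intro n; unfold G; pose proof (Cmod_ge_0 (pseq a b z0 n));
  pose proof (Cmod_ge_0 (qseq a b z0 n)); lra. }
assert (hpG : forall n, Cmod (pseq a b z0 n) <= G n).
{ intro n; unfold G; pose proof (Cmod_ge_0 (qseq a b z0 n)); lra. }
assert (hqG : forall n, Cmod (qseq a b z0 n) <= G n).
{ intro n; unfold G; pose proof (Cmod_ge_0 (pseq a b z0 n)); lra. }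
assert (hG : ex_series (fun n => G n ^ 2)).
{ apply (ex_series_le (K := R_AbsRing) (V := R_CompleteNormedModule) _
    (fun n => 2 * Cmod (pseq a b z0 n) ^ 2 + 2 * Cmod (qseq a b z0 n) ^ 2)).
  - intro n; change (Rabs (G n ^ 2) <= 2 * Cmod (pseq a b z0 n) ^ 2
      + 2 * Cmod (qseq a b z0 n) ^ 2).
    rewrite Rabs_pos_eq by apply pow2_ge_0; unfold G.
    pose proof (pow2_ge_0 (Cmod (pseq a b z0 n) - Cmod (qseq a b z0 n))); nra.
  - apply (ex_series_plus (K := R_AbsRing) (V := R_NormedModule)).
    + exact (ex_series_scal_l (K := R_AbsRing) (V := R_NormedModule) _ _ hp).
    + exact (ex_series_scal_l (K := R_AbsRing) (V := R_NormedModule) _ _ hq). }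
set (K := Cmod (z - z0)).
assert (hK : 0 <= K) by apply Cmod_ge_0.
(* [X n] bounds the coefficients of both [q] and [p] in the formula for [u (S n)]. It grows by a
   factor at most [1 + K * G (S n) ^ 2], and [G ^ 2] is summable, so [X] is bounded and [u] is
   dominated by a multiple of [G]. *)
pose (X := fun n => Cmod c + Cmod (u 0%nat) + K * sum_n (fun m => G m * Cmod (u m)) n).
assert (hstep : forall n, Cmod (u (S n)) <= G (S n) * X n).
{ intro n; pose proof (variation_of_constants a b ha z0 z c u hu (S n)) as h.
  rewrite !sum_n_SC in h.
  pose proof (Cmod_sum_n_mult_le _ u G (z - z0) n hpG) as hA.
  pose proof (Cmod_sum_n_mult_le _ u G (z - z0) n hqG) as hB.
  fold K in hA, hB.
  set (A := sum_n (fun m => pseq a b z0 m * ((z - z0) * u m))%C n : C) in *.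
  set (B := sum_n (fun m => qseq a b z0 m * ((z - z0) * u m))%C n : C) in *.
  set (s := sum_n (fun m => G m * Cmod (u m)) n : R) in *.
  (* The terms of index [S n] in the two sums cancel, so the right side contains only entries of [u]
     up to [n]; otherwise the estimate would be circular. *)
  replace (u (S n)) with (qseq a b z0 (S n) * (c + A) + pseq a b z0 (S n) * (u 0%nat - B))%C
    by (rewrite h at 1; ring).
  eapply Rle_trans; [apply Cmod_triangle|]; rewrite !Cmod_mult.
  pose proof (Cmod_triangle c A).
  assert (h2 : Cmod (u 0%nat - B) <= Cmod (u 0%nat) + Cmod B).
  { rewrite <- (Cmod_opp B); apply Cmod_triangle. }
  change (G (S n)) with (Cmod (pseq a b z0 (S n)) + Cmod (qseq a b z0 (S n))).
  unfold X; fold s.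
  pose proof (Cmod_ge_0 (pseq a b z0 (S n))); pose proof (Cmod_ge_0 (qseq a b z0 (S n))).
  pose proof (Cmod_ge_0 c); pose proof (Cmod_ge_0 (u 0%nat)).
  rewrite Rmult_plus_distr_r, Rplus_comm.
  apply Rplus_le_compat; apply Rmult_le_compat_l; trivial; lra. }
assert (hX0 : 0 <= X 0%nat).
{ unfold X; rewrite sum_n_OR; pose proof (Cmod_ge_0 c); pose proof (Cmod_ge_0 (u 0%nat)).
  assert (0 <= G 0%nat * Cmod (u 0%nat)) by now apply Rmult_le_pos.
  assert (0 <= K * (G 0%nat * Cmod (u 0%nat))) by now apply Rmult_le_pos.
  lra. }
assert (hX : forall n, X n <= X 0%nat * exp (K * sum_n (fun m => G m ^ 2) n)).
{ apply discrete_gronwall; trivial.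
  - intro n; apply pow2_ge_0.
  - intro n; unfold X at 1; rewrite sum_n_SR.
    pose proof (Rmult_le_compat_l _ _ _ hK (Rmult_le_compat_l _ _ _ (hG0 (S n)) (hstep n))).
    unfold X in *; lra. }
set (M := X 0%nat * exp (K * Series (fun m => G m ^ 2))).
assert (hM : forall n, X n <= M).
{ intro n; eapply Rle_trans; [apply hX|]; unfold M.
  apply Rmult_le_compat_l; trivial.
  assert (h1 : K * sum_n (fun m => G m ^ 2) n <= K * Series (fun m => G m ^ 2)).
  { apply Rmult_le_compat_l; trivial.
    apply partial_sum_le_Series; trivial; intro k; apply pow2_ge_0. }
  destruct h1 as [h1|h1]; [left; now apply exp_increasing|right; now rewrite h1]. }
apply (ex_series_incr_1 (K := R_AbsRing) (V := R_NormedModule)).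
apply (ell2_le (fun n => u (S n)) (fun n => M ^ 2 * G (S n) ^ 2)).
- intro n; rewrite <- Rpow_mult_distr; apply pow_incr; split; [apply Cmod_ge_0|].
  eapply Rle_trans; [apply hstep|]; rewrite Rmult_comm.
  now apply Rmult_le_compat_r.
- apply (ex_series_scal_l (K := R_AbsRing) (V := R_NormedModule)).
  exact (proj1 (ex_series_incr_1 (K := R_AbsRing) (V := R_NormedModule) _) hG).
Qed.

Lemma limit_circle_ell2 (a b : nat -> R) (ha : forall n, 0 < a n) (z : C) :
  ~ op_eq (clos (Jmin a b)) (Jmax a b) -> ell2 (pseq a b z) /\ ell2 (qseq a b z).
Proof.
intro hlc; pose proof (limit_circle_pseq_Ci a b ha hlc) as hp.
assert (hq : ell2 (qseq a b Ci)).
{ apply (ell2_le _ (fun n => Cmod (pseq a b Ci n) ^ 2)); trivial.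
  intro n; apply pow_incr; split; [apply Cmod_ge_0|].
  now apply Cmod_qseq_le_pseq_Ci. }
split.
- apply (ell2_solution_transfer a b ha Ci z 0); trivial.
  intro n; rewrite jshift_pseq by trivial; now destruct n.
- apply (ell2_solution_transfer a b ha Ci z 1); trivial.
  intro n; now apply jshift_qseq.
Qed.

(** * The resolvent *)

Lemma is_series_C_components (x : nat -> C) (l : C) :
  is_series (fun n => Re (x n)) (Re l) -> is_series (fun n => Im (x n)) (Im l) ->
  is_series x l.
Proof.
intros h1 h2.
assert (e : forall n, (sum_n (fun k => Re (x k)) n, sum_n (fun k => Im (x k)) n)
  = sum_n x n :> C).
{ induction n as [|n IH].
  - rewrite !sum_n_OR, sum_n_OC; symmetry; apply surjective_pairing.
  - rewrite !sum_n_SR, sum_n_SC, <- IH; reflexivity. }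
apply (filterlim_ext _ _ e), filterlim_locally; intro eps.
pose proof (proj1 (filterlim_locally (U := R_UniformSpace) _ _) h1 eps) as e1.
pose proof (proj1 (filterlim_locally (U := R_UniformSpace) _ _) h2 eps) as e2.
generalize (filter_and _ _ e1 e2); apply filter_imp; intros n [H1 H2]; split; trivial.
Qed.

Lemma ex_series_C_abs (x : nat -> C) :
  ex_series (fun n => Cmod (x n)) -> exists l : C, is_series x l.
Proof.
intro h.
assert (h1 : ex_series (fun n => Re (x n))).
{ apply (ex_series_le (K := R_AbsRing) (V := R_CompleteNormedModule) _ _) with (2 := h).
  intro n; apply re_le_Cmod. }
assert (h2 : ex_series (fun n => Im (x n))).
{ apply (ex_series_le (K := R_AbsRing) (V := R_CompleteNormedModule) _ _) with (2 := h).
  intro n; exact (Rle_trans _ _ _ (Rmax_r _ _) (Rmax_Cmod (x n))). }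
destruct h1 as [l1 h1]; destruct h2 as [l2 h2].
exists (l1, l2); now apply is_series_C_components.
Qed.

Lemma is_series_C_unique (x : nat -> C) (l m : C) :
  is_series x l -> is_series x m -> l = m.
Proof.
exact (@filterlim_locally_unique nat C_AbsRing C_NormedModule eventually _ (sum_n x) l m).
Qed.

(** Subtracting partial sums from [s] replaces the separate series in each entry by one constant,
    which is the form of [jshift_particular]; it also shows that [g] is determined by [h]. *)
Lemma resolvent_iff (a b : nat -> R) (z s : C) (h : cseq) : ell2 h ->
  is_series (fun m => qseq a b z m * h m)%C s ->
  forall g, resolvent a b z h g <->
    forall n, g n = (qseq a b z n * sum_n (fun m => pseq a b z m * h m) n
      + pseq a b z n * (s - sum_n (fun m => qseq a b z m * h m) n))%C.
Proof.
intros hh hs g.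
set (x := (fun m => qseq a b z m * h m)%C : cseq) in *.
assert (htail : forall n, is_series (fun k => x (n + 1 + k)%nat) (s - sum_n x n)%C).
{ intro n; apply (is_series_incr_n x (n + 1)); [lia|].
  replace (Init.Nat.pred (n + 1)) with n by lia.
  replace (plus _ _) with s; trivial.
  change (s = s - sum_n x n + sum_n x n)%C; ring. }
split.
- intros [_ hg] n; destruct (hg n) as [t [ht ->]].
  now rewrite (is_series_C_unique _ _ _ ht (htail n)).
- intro hg; split; trivial; intro n; exists (s - sum_n x n)%C; split; [apply htail|apply hg].
Qed.

(** Products of two [ell2] sequences are absolutely summable, so both brackets stay bounded, and a
    bounded factor preserves [ell2]. *)
Lemma ell2_resolvent (p q h : cseq) (s : C) : ell2 p -> ell2 q -> ell2 h ->
  ell2 (fun n => q n * sum_n (fun m => p m * h m) n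
      + p n * (s - sum_n (fun m => q m * h m) n))%C.
Proof.
intros hp hq hh.
assert (hb : forall v : cseq, ell2 v -> exists M, forall n,
  Cmod (sum_n (fun m => v m * h m)%C n) <= M).
{ intros v hv; exists (Series (fun m => Cmod (v m) * Cmod (h m))); intro n.
  eapply Rle_trans; [apply Cmod_sum_n_le|].
  rewrite (sum_n_ext _ (fun m => Cmod (v m) * Cmod (h m))) by (intro; apply Cmod_mult).
  apply partial_sum_le_Series; [|now apply ell2_mult].
  intro k; apply Rmult_le_pos; apply Cmod_ge_0. }
assert (hm : forall (v x : cseq) (M : R), ell2 v -> (forall n, Cmod (x n) <= M) ->
  ell2 (fun n => v n * x n)%C).
{ intros v x M hv hx.
  apply (ell2_le _ (fun n => M ^ 2 * Cmod (v n) ^ 2)).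
  - intro n; rewrite <- Rpow_mult_distr; apply pow_incr; split; [apply Cmod_ge_0|].
    rewrite Cmod_mult, Rmult_comm; apply Rmult_le_compat_r; [apply Cmod_ge_0|apply hx].
  - exact (ex_series_scal_l (K := R_AbsRing) (V := R_NormedModule) _ _ hv). }
destruct (hb p hp) as [M hM]; destruct (hb q hq) as [N hN].
apply ell2_plus; [exact (hm q _ M hq hM)|].
apply (hm p _ (Cmod s + N) hp); intro n.
eapply Rle_trans; [apply Cmod_triangle|].
rewrite Cmod_opp; apply Rplus_le_compat_l, hN.
Qed.

Theorem theorem2p1 (a b : nat -> R) (ha : forall n : nat, (0 < a n)%R)
    (hlc : ~ op_eq (clos (Jmin a b)) (Jmax a b)) :
  forall z : C,
    (forall h : cseq, ell2 h ->
       exists g : cseq, resolvent a b z h g /\ dom (Jmax a b) g) /\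
    op_eq (op_comp (op_shift (Jmax a b) z) (resolvent a b z)) op_id.
Proof.
intro z; destruct (limit_circle_ell2 a b ha z hlc) as [hp hq].
(* The last clause speaks of every [g'] because composition of graphs supplies an arbitrary
   intermediate sequence. *)
assert (key : forall h, ell2 h -> exists g, resolvent a b z h g /\
  Jmax a b g (jacobi a b g) /\ forall g', resolvent a b z h g' ->
  (fun n => jacobi a b g' n - z * g' n)%C = h).
{ intros h hh.
  destruct (ex_series_C_abs (fun m => qseq a b z m * h m)%C) as [s hs].
  { apply (ex_series_ext (K := R_AbsRing) (V := R_NormedModule)
      (fun n => Cmod (qseq a b z n) * Cmod (h n))).
    - intro n; symmetry; apply Cmod_mult.
    - now apply ell2_mult. }
  pose proof (resolvent_iff a b z s h hh hs) as hr.
  pose proof (jshift_particular a b ha z s h) as hj.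
  set (g := (fun n => qseq a b z n * sum_n (fun m => pseq a b z m * h m) n
      + pseq a b z n * (s - sum_n (fun m => qseq a b z m * h m) n))%C : cseq) in *.
  assert (hg : ell2 g) by now apply ell2_resolvent.
  exists g; split; [now apply hr|split].
  - split; trivial; split; trivial.
    (* Membership of [J g] in [ell2] comes from the equation itself, [J g = h + z g]. *)
    apply (ell2_ext (fun n => h n + z * g n)%C).
    + intro n; rewrite <- (hj n); unfold jshift; ring.
    + now apply ell2_plus; [|apply ell2_scal].
  - intros g' hg'; apply functional_extensionality; intro n.
    rewrite <- (hj n); apply jshift_ext; intro m; now apply hr. }
split.
- intros h hh; destruct (key h hh) as [g [h1 [h2 _]]].
  exists g; split; trivial; now exists (jacobi a b g).
- intros h w; split.
  + intros [g [hg [v [[_ ->] ->]]]].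
    assert (hh : ell2 h) by apply hg.
    destruct (key h hh) as [_ [_ [_ h3]]]; split; trivial; now apply h3.
  + intros [hh ->]; destruct (key h hh) as [g [h1 [h2 h3]]].
    exists g; split; trivial; exists (jacobi a b g); split; trivial.
    symmetry; now apply h3.
Qed.
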